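(* Let $\mathcal{T}\in\mathbb{R}^{I\times J\times I\times J}$ and let $\mathcal{T}=\mathcal{U}\ast_2\mathcal{S}\ast_2\mathcal{V}^T$ be a tensor singular value decomposition of $\mathcal{T}$, i.e. $\mathcal{U},\mathcal{V}\in\mathbb{R}^{I\times J\times I\times J}$ are orthogonal tensors and $\mathcal{S}\in\mathbb{R}^{I\times J\times I\times J}$ is a diagonal tensor with diagonal entries $\sigma_{klkl}$. Suppose there exist matrices $\mathbf{A}\in\mathbb{R}^{I\times I}$, $\mathbf{B}\in\mathbb{R}^{J\times J}$, $\mathbf{C}\in\mathbb{R}^{I\times I}$, $\mathbf{D}\in\mathbb{R}^{J\times J}$ such that $a_{ik}b_{jl}=u_{ijkl}$ and $c_{ik}d_{jl}=v_{ijkl}$ for all $i,k\in\{1,\dots,I\}$ and $j,l\in\{1,\dots,J\}$. Then the tensor SVD is a multilinear SVD of $\mathcal{T}$ with core tensor $\mathcal{S}$: $$\mathcal{T}=\mathcal{S}\bullet_1\mathbf{A}\bullet_2\mathbf{B}\bullet_3\mathbf{C}\bullet_4\mathbf{D},\qquad\text{i.e.}\qquad t_{ij\hat i\hat j}=\sum_{k=1}^{I}\sum_{l=1}^{J}\sigma_{klkl}\,a_{ik}b_{jl}c_{\hat ik}d_{\hat jl},$$ where moreover the matrices $\mathbf{A},\mathbf{B},\mathbf{C},\mathbf{D}$ satisfying these factorization identities can be chosen orthogonal.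
   Context: For $\mathcal{X},\mathcal{Y}\in\mathbb{R}^{I\times J\times I\times J}$: the Einstein product is $(\mathcal{X}\ast_2\mathcal{Y})_{ij\hat i\hat j}=\sum_{u=1}^{I}\sum_{v=1}^{J}x_{ijuv}y_{uv\hat i\hat j}$; the transpose is $(\mathcal{X}^T)_{ijkl}=x_{klij}$; $\mathcal{X}$ is orthogonal if $\mathcal{X}^T\ast_2\mathcal{X}=\mathcal{I}$, where $\mathcal{I}$ has entries $\delta_{ik}\delta_{jl}$; $\mathcal{X}$ is diagonal if $x_{ijkl}=0$ unless $i=k$ and $j=l$. The Tucker mode-$n$ product $\bullet_n$ of a tensor with a matrix contracts the $n$-th index of the tensor with the second index of the matrix, so that $(\mathcal{S}\bullet_1\mathbf{A}\bullet_2\mathbf{B}\bullet_3\mathbf{C}\bullet_4\mathbf{D})_{ij\hat i\hat j}=\sum_{p,q,r,s}s_{pqrs}\,a_{ip}b_{jq}c_{\hat ir}d_{\hat js}$. A multilinear SVD of a fourth order tensor is an expression of it in this form with orthogonal square factor matrices and a core tensor of the same size. *)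

(* Defs.v *)
From HB Require Import structures.
From mathcomp Require Import all_boot all_order all_algebra.
From mathcomp Require Import reals.

Set Implicit Arguments.
Unset Strict Implicit.
Unset Printing Implicit Defensive.

Import GRing.Theory Num.Theory.
Local Open Scope ring_scope.

Definition tensor4 (R : Type) (I J K L : nat) : Type :=
  {ffun 'I_I * 'I_J * 'I_K * 'I_L -> R}.

Section Tensors.
Variable R : realType.

Definition einstein2 (I J K L M N : nat)
    (X : tensor4 R I J K L) (Y : tensor4 R K L M N) : tensor4 R I J M N :=
  [ffun x => let: (i, j, m, n) := x in
     \sum_(u < K) \sum_(v < L) X (i, j, u, v) * Y (u, v, m, n)].

Definition tr4 (I J K L : nat) (X : tensor4 R I J K L) : tensor4 R K L I J :=
  [ffun x => let: (k, l, i, j) := x in X (i, j, k, l)].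

Definition id4 (I J : nat) : tensor4 R I J I J :=
  [ffun x => let: (i, j, k, l) := x in (i == k)%:R * (j == l)%:R].

Definition orthogonal4 (I J : nat) (X : tensor4 R I J I J) : Prop :=
  einstein2 (tr4 X) X = id4 I J.

Definition diagonal4 (I J : nat) (X : tensor4 R I J I J) : Prop :=
  forall i j k l, ~ (i = k /\ j = l) -> X (i, j, k, l) = 0.

Definition orthogonal_mx (n : nat) (A : 'M[R]_n) : Prop := A^T *m A = 1%:M.

Definition mode1 (I J K L M : nat) (S : tensor4 R I J K L) (A : 'M[R]_(M, I)) :
    tensor4 R M J K L :=
  [ffun x => let: (i, j, k, l) := x in \sum_(p < I) S (p, j, k, l) * A i p].

Definition mode2 (I J K L M : nat) (S : tensor4 R I J K L) (B : 'M[R]_(M, J)) :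
    tensor4 R I M K L :=
  [ffun x => let: (i, j, k, l) := x in \sum_(q < J) S (i, q, k, l) * B j q].

Definition mode3 (I J K L M : nat) (S : tensor4 R I J K L) (C : 'M[R]_(M, K)) :
    tensor4 R I J M L :=
  [ffun x => let: (i, j, k, l) := x in \sum_(r < K) S (i, j, r, l) * C k r].

Definition mode4 (I J K L M : nat) (S : tensor4 R I J K L) (D : 'M[R]_(M, L)) :
    tensor4 R I J K M :=
  [ffun x => let: (i, j, k, l) := x in \sum_(s < L) S (i, j, k, s) * D l s].

Definition tensor_svd (I J : nat) (T U S V : tensor4 R I J I J) : Prop :=
  [/\ orthogonal4 U, orthogonal4 V, diagonal4 S
    & T = einstein2 (einstein2 U S) (tr4 V)].

Definition multilinear_svd (I J K L : nat) (T S : tensor4 R I J K L)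
    (A : 'M[R]_I) (B : 'M[R]_J) (C : 'M[R]_K) (D : 'M[R]_L) : Prop :=
  [/\ orthogonal_mx A, orthogonal_mx B, orthogonal_mx C, orthogonal_mx D
    & T = mode4 (mode3 (mode2 (mode1 S A) B) C) D].

Definition mx_factorization (I J : nat) (X : tensor4 R I J I J)
    (A : 'M[R]_I) (B : 'M[R]_J) : Prop :=
  forall (i k : 'I_I) (j l : 'I_J), A i k * B j l = X (i, j, k, l).

End Tensors.

(* Main.v *)
(* Transposing and contracting, the orthogonality of a factored tensor reads
   (A^T A)_{kk'} (B^T B)_{ll'} = delta_{kk'} delta_{ll'}, so A^T A and B^T B are
   scalar matrices a I and a^-1 I with a > 0; dividing A and multiplying B by
   sqrt a makes both orthogonal without changing the products a_{ik} b_{jl}. *)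
Require Import Defs.
From HB Require Import structures.
From mathcomp Require Import all_boot all_order all_algebra.
From mathcomp Require Import reals.

Set Implicit Arguments.
Unset Strict Implicit.
Unset Printing Implicit Defensive.

Import GRing.Theory Num.Theory.
Local Open Scope ring_scope.

(** In each entry of $X^T\ast_2 X$ the summand separates into a factor in [u] and a factor in [v],
    so the double sum is a product of two Gram entries. *)
Lemma mx_factorization_gram (R : realType) (I J : nat) (X : tensor4 R I J I J)
    (A : 'M[R]_I) (B : 'M[R]_J) :
  orthogonal4 X -> mx_factorization X A B ->
  forall k k' l l',
    (A^T *m A) k k' * (B^T *m B) l l' = (k == k')%:R * (l == l')%:R.
Proof.
move=> oX fX k k' l l'.
have /ffunP/(_ (k, l, k', l')) := oX; rewrite !ffunE => <-.
rewrite !mxE mulr_suml; apply: eq_bigr => u _.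
rewrite mulr_sumr; apply: eq_bigr => v _.
by rewrite !ffunE -!fX !mxE mulrACA.
Qed.

Lemma orthogonal_mx_factorization (R : realType) (I J : nat)
    (X : tensor4 R I J I J) (A : 'M[R]_I) (B : 'M[R]_J) :
  orthogonal4 X -> mx_factorization X A B ->
  exists (A' : 'M[R]_I) (B' : 'M[R]_J),
    [/\ orthogonal_mx A', orthogonal_mx B' & mx_factorization X A' B'].
Proof.
move=> oX fX.
have orth1 n : orthogonal_mx (1%:M : 'M[R]_n) by rewrite /orthogonal_mx trmx1 mulmx1.
(* The scale is read off at a fixed pair of indices [k0], [l0]. If [I] or [J] is 0 there is none,
   but the factorization is then vacuous and identity matrices serve. *)
have [k0 _|I0] := pickP 'I_I; last first.
  by exists 1%:M, 1%:M; split=> // i; have := I0 i.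
have [l0 _|J0] := pickP 'I_J; last first.
  by exists 1%:M, 1%:M; split=> // i k j; have := J0 j.
have gram := mx_factorization_gram oX fX.
set a := (A^T *m A) k0 k0; set b := (B^T *m B) l0 l0.
have ab1 : a * b = 1 by rewrite gram !eqxx mulr1.
have a_neq0 : a != 0.
  by apply/eqP=> a0; move: ab1; rewrite a0 mul0r => /eqP; rewrite eq_sym oner_eq0.
(* As a sum of squares, [a] is the square of its root. *)
have a_ge0 : 0 <= a.
  by rewrite /a mxE; apply: sumr_ge0 => i _; rewrite mxE -expr2 sqr_ge0.
have bE : b = a^-1 by rewrite -[LHS]mul1r -(mulVf a_neq0) -mulrA ab1 mulr1.
have sqr_c : Num.sqrt a * Num.sqrt a = a by rewrite -expr2 sqr_sqrtr.
have c_neq0 : Num.sqrt a != 0.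
  by apply: contraNneq a_neq0 => c0; rewrite -sqr_c c0 mul0r.
exists ((Num.sqrt a)^-1 *: A), (Num.sqrt a *: B); split.
(* The rescaled Gram matrix is $b\,A^TA$; its entries are the Gram identity at [l = l' = l0]. *)
- rewrite /orthogonal_mx -scalemxAr [(_ *: _)^T]linearZ /= -scalemxAl scalerA -invfM sqr_c -bE.
  apply/matrixP=> k k'.
  by rewrite [LHS]mxE [RHS]mxE mulrC gram eqxx mulr1.
- rewrite /orthogonal_mx -scalemxAr [(_ *: _)^T]linearZ /= -scalemxAl scalerA sqr_c.
  apply/matrixP=> l l'.
  by rewrite [LHS]mxE [RHS]mxE gram eqxx mul1r.
- by move=> i k j l; rewrite !mxE -fX mulrACA mulVf // mul1r.
Qed.

(** Both sides are the same fourfold sum. The Einstein products put the first index of each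
    contracted pair outermost, the mode products the second, hence one exchange per pair. *)
Lemma einstein2_mode_product (R : realType) (I J : nat) (U S V : tensor4 R I J I J)
    (A : 'M[R]_I) (B : 'M[R]_J) (C : 'M[R]_I) (D : 'M[R]_J) :
  mx_factorization U A B -> mx_factorization V C D ->
  einstein2 (einstein2 U S) (tr4 V) = mode4 (mode3 (mode2 (mode1 S A) B) C) D.
Proof.
move=> fU fV; apply/ffunP=> -[[[i j] i'] j']; rewrite !ffunE exchange_big /=.
apply: eq_bigr => v _; rewrite !ffunE mulr_suml; apply: eq_bigr => u _.
rewrite !ffunE -fV mulrA; congr (_ * _ * _).
rewrite exchange_big /=; apply: eq_bigr => q _.
rewrite !ffunE mulr_suml; apply: eq_bigr => p _.
by rewrite -fU mulrC mulrA.
Qed.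

(** Diagonality collapses the inner contraction of [U] with [S] to its term at [(k, l)]. *)
Lemma einstein2_diagonalE (R : realType) (I J : nat) (U S V : tensor4 R I J I J)
    (i i' : 'I_I) (j j' : 'I_J) :
  diagonal4 S ->
  einstein2 (einstein2 U S) (tr4 V) (i, j, i', j') =
    \sum_(k < I) \sum_(l < J) U (i, j, k, l) * S (k, l, k, l) * V (i', j', k, l).
Proof.
move=> dS; rewrite ffunE; apply: eq_bigr => k _; apply: eq_bigr => l _.
rewrite !ffunE; congr (_ * _).
rewrite (bigD1 k) //= [X in _ + X]big1 ?addr0 => [|p pk]; last first.
  by apply: big1 => q _; rewrite dS ?mulr0 // => -[/eqP]; rewrite (negPf pk).
rewrite (bigD1 l) //= [X in _ + X]big1 ?addr0 // => q ql.
by rewrite dS ?mulr0 // => -[_ /eqP]; rewrite (negPf ql).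
Qed.

Theorem lemma3p18 (R : realType) (I J : nat) (T U S V : tensor4 R I J I J)
    (A : 'M[R]_I) (B : 'M[R]_J) (C : 'M[R]_I) (D : 'M[R]_J)
    (hSVD : tensor_svd T U S V)
    (hU : mx_factorization U A B) (hV : mx_factorization V C D) :
  [/\ T = mode4 (mode3 (mode2 (mode1 S A) B) C) D,
      forall (i : 'I_I) (j : 'I_J) (i' : 'I_I) (j' : 'I_J),
        T (i, j, i', j') =
          \sum_(k < I) \sum_(l < J)
             S (k, l, k, l) * A i k * B j l * C i' k * D j' l
    & exists (A' : 'M[R]_I) (B' : 'M[R]_J) (C' : 'M[R]_I) (D' : 'M[R]_J),
        [/\ mx_factorization U A' B', mx_factorization V C' D'
          & multilinear_svd T S A' B' C' D']].
Proof.
have [oU oV dS ->] := hSVD; split.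
- exact: einstein2_mode_product.
- move=> i j i' j'; rewrite einstein2_diagonalE //.
  apply: eq_bigr => k _; apply: eq_bigr => l _.
  by rewrite -hU -hV [_ * S _]mulrC !mulrA.
(* The orthogonal matrices factor the same [U] and [V], so the mode product identity applies again
   with the same core [S]. *)
have [A' [B' [oA oB fU]]] := orthogonal_mx_factorization oU hU.
have [C' [D' [oC oD fV]]] := orthogonal_mx_factorization oV hV.
exists A', B', C', D'; split=> //; split=> //.
exact: einstein2_mode_product.
Qed.
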